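(* Suppose that $OABC$ is a tangential LEQ with consecutive side lengths $a=OA$, $b=AB$, $c=BC$, $d=CO$ and vertices $O,A,B,C$ in positive (counterclockwise) cyclic order, and suppose that if $OABC$ is concave, then its reflex angle is at $B$. Let $\sigma,\tau$ be the quantities attached to $OABC$ defined in the context, and suppose that $a$ and $c$ are even in the case $\sigma=\tau=2$. Then the following conditions hold: (i) $|c-b|\,\tau<a+c$; (ii) $(a+d)\,\tau>a+c$; (iii) $(b+c)\,\tau\neq a+c$. Moreover, $OABC$ is convex if and only if $(b+c)\,\tau>a+c$. Furthermore, there are two cases (either $\tau\in\{2,3,5,9\}$ or $\sigma\in\{3,5,9\}$): (I) If $\tau\in\{2,3,5,9\}$, then $a$ and $\tau b$ have the same parity and, setting $u=\frac{\tau b-a}{2}$, $v=\frac{\tau b+a}{2}$, we have $$(2\tau)^2+u^2=v^2-\Big(v-\frac{\tau-1}{2}c\Big)^2.$$ (II) If $\sigma\in\{3,5,9\}$, then $a$ and $\sigma d$ have the same parity and, setting $u=\frac{\sigma d-a}{2}$, $v=\frac{\sigma d+a}{2}$, we have $$(2\sigma)^2+u^2=v^2-\Big(v-\frac{\sigma-1}{2}c\Big)^2.$$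
   Context: A quadrilateral $OABC$ is given by four points of the plane, no three colinear, such that the segments $OA,AB,BC,CO$ have no interior points of intersection (no self-intersections); it may be convex or concave. A lattice equable quadrilateral (LEQ) is a quadrilateral whose vertices lie on $\mathbb Z^2$ and whose area equals its perimeter; the side lengths of a LEQ are known to be integers. A quadrilateral is tangential if it has an incircle, i.e. a circle inside it tangent to its four sides (in the concave case, to the sides or their extensions); by Pitot's theorem this is equivalent to $a+c=b+d$, where $a,b,c,d$ are the lengths of $OA,AB,BC,CO$. For a tangential LEQ $OABC$ define $$\sigma=\frac{ad+bc+2\delta\sqrt{abcd-4(a+c)^2}}{16+(a-b)^2},\qquad \tau=\frac{ab+cd-2\delta\sqrt{abcd-4(a+c)^2}}{16+(a-d)^2},$$ where $\delta=1$ if $B$ lies within the circumcircle of the triangle $OAC$, and $\delta=-1$ otherwise. *)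

(* Defs.v *)
From Stdlib Require Import Reals ZArith ClassicalEpsilon.
Local Open Scope R_scope.

Definition point : Type := (R * R)%type.

Definition seg_length (P Q : point) : R :=
  dist_euc (fst P) (snd P) (fst Q) (snd Q).

Definition lattice_point (P : point) : Prop :=
  exists m n : Z, P = (IZR m, IZR n).

Definition point_at (P Q : point) (t : R) : point :=
  ((1 - t) * fst P + t * fst Q, (1 - t) * snd P + t * snd Q).

Definition on_line (P Q X : point) : Prop :=
  exists t : R, X = point_at P Q t.

Definition on_segment (P Q X : point) : Prop :=
  exists t : R, 0 <= t <= 1 /\ X = point_at P Q t.

Definition interior_of_segment (P Q X : point) : Prop :=
  exists t : R, 0 < t < 1 /\ X = point_at P Q t.

Definition no_common_interior_point (P Q P' Q' : point) : Prop :=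
  forall X : point,
    ~ (interior_of_segment P Q X /\ interior_of_segment P' Q' X).

Definition collinear (P Q S : point) : Prop :=
  P = Q \/ on_line P Q S.

Definition quadrilateral (O A B C : point) : Prop :=
  ~ collinear O A B /\ ~ collinear A B C /\
  ~ collinear B C O /\ ~ collinear C O A /\
  no_common_interior_point O A A B /\
  no_common_interior_point O A B C /\
  no_common_interior_point O A C O /\
  no_common_interior_point A B B C /\
  no_common_interior_point A B C O /\
  no_common_interior_point B C C O.

(* The vector product of PQ and PS: positive iff S is strictly to the left of
   the line directed from P to Q. *)
Definition cross (P Q S : point) : R :=
  (fst Q - fst P) * (snd S - snd P) - (snd Q - snd P) * (fst S - fst P).

Definition in_triangle (P Q S X : point) : Prop :=
  exists u v w : R,
    0 <= u /\ 0 <= v /\ 0 <= w /\ u + v + w = 1 /\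
    X = (u * fst P + v * fst Q + w * fst S,
         u * snd P + v * snd Q + w * snd S).

Definition line_separates (P Q S T : point) : Prop :=
  cross P Q S * cross P Q T < 0.

(* The closed region bounded by the quadrilateral OABC.  A diagonal of a
   quadrilateral runs inside it exactly when its line separates the two other
   vertices; it then cuts the region into two triangles.  When both diagonals
   are inside (the convex case), both unions are the same set. *)
Definition region (O A B C X : point) : Prop :=
  (line_separates O B A C /\ (in_triangle O A B X \/ in_triangle O B C X)) \/
  (line_separates A C O B /\ (in_triangle A B C X \/ in_triangle A C O X)).

Definition convex (O A B C : point) : Prop :=
  forall X Y Z : point,
    region O A B C X -> region O A B C Y -> on_segment X Y Z ->
    region O A B C Z.

(* Area enclosed by the polygon OABC, with sign + iff the vertices are in
   counterclockwise order (Gauss's shoelace formula). *)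
Definition signed_area (O A B C : point) : R :=
  ((fst O * snd A - fst A * snd O) + (fst A * snd B - fst B * snd A) +
   (fst B * snd C - fst C * snd B) + (fst C * snd O - fst O * snd C)) / 2.

Definition area (O A B C : point) : R := Rabs (signed_area O A B C).

Definition counterclockwise (O A B C : point) : Prop :=
  0 < signed_area O A B C.

(* For consecutive vertices P, Q, S of a counterclockwise polygon, the
   interior angle at Q is the angle in (0, 2 pi) from QS counterclockwise to
   QP, and [cross Q S P] has the sign of its sine. *)
Definition reflex_at (P Q S : point) : Prop := cross Q S P < 0.

Definition perimeter (O A B C : point) : R :=
  seg_length O A + seg_length A B + seg_length B C + seg_length C O.

Definition LEQ (O A B C : point) : Prop :=
  quadrilateral O A B C /\
  lattice_point O /\ lattice_point A /\ lattice_point B /\ lattice_point C /\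
  area O A B C = perimeter O A B C.

(* The line PQ meets the circle of centre I and radius r in the single
   point T. *)
Definition tangent_at (I : point) (r : R) (P Q T : point) : Prop :=
  forall X : point, (on_line P Q X /\ seg_length I X = r) <-> X = T.

(* In the concave case the points of tangency may lie on the extensions of the
   sides. *)
Definition incircle (O A B C : point) (I : point) (r : R) : Prop :=
  0 < r /\
  (forall X : point, seg_length I X <= r -> region O A B C X) /\
  exists T1 T2 T3 T4 : point,
    tangent_at I r O A T1 /\ tangent_at I r A B T2 /\
    tangent_at I r B C T3 /\ tangent_at I r C O T4 /\
    (convex O A B C ->
       on_segment O A T1 /\ on_segment A B T2 /\
       on_segment B C T3 /\ on_segment C O T4).

Definition tangential (O A B C : point) : Prop :=
  exists (I : point) (r : R), incircle O A B C I r.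

Definition within_circumcircle (P Q S X : point) : Prop :=
  exists (Z : point) (rho : R),
    seg_length Z P = rho /\ seg_length Z Q = rho /\ seg_length Z S = rho /\
    seg_length Z X < rho.

Definition delta (O A B C : point) : R :=
  if excluded_middle_informative (within_circumcircle O A C B)
  then 1 else -1.

Definition leq_sigma (O A B C : point) : R :=
  let a := seg_length O A in let b := seg_length A B in
  let c := seg_length B C in let d := seg_length C O in
  (a * d + b * c
     + 2 * delta O A B C * sqrt (a * b * c * d - 4 * (a + c) ^ 2))
  / (16 + (a - b) ^ 2).

Definition leq_tau (O A B C : point) : R :=
  let a := seg_length O A in let b := seg_length A B in
  let c := seg_length B C in let d := seg_length C O in
  (a * b + c * d
     - 2 * delta O A B C * sqrt (a * b * c * d - 4 * (a + c) ^ 2))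
  / (16 + (a - d) ^ 2).

Definition even_real (x : R) : Prop :=
  exists m : Z, x = IZR m /\ Z.Even m.

(* In particular, both x and y are integers. *)
Definition same_parity (x y : R) : Prop :=
  exists m n : Z, x = IZR m /\ y = IZR n /\ Z.even m = Z.even n.

(* Main.v *)
(* Let e, f, g, h be the tangent lengths at O, A, B, C, with g < 0 when B is a
   reflex corner. Equability makes the inradius 2, and with X = e + g,
   Y = f + h one finds sigma = (a + c) / X and tau = (a + c) / Y, so that
   1 / sigma + 1 / tau = 1; the inequalities only express that e, f, h > 0 and
   that g > 0 exactly in the convex case. Moreover sigma (e^2 + 4) = a d, while
   sigma (e^2 - 4) is the scalar product of OA and OC, so 8 sigma is an integer;
   likewise 8 tau is one, and (8 sigma - 8) (8 tau - 8) = 64 leaves only the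
   listed values. The quadratic identities are tau (f^2 + 4) = a b and
   sigma (e^2 + 4) = a d. *)
Require Import Defs.
From Stdlib Require Import Reals List ZArith Lra Lia ClassicalEpsilon.
Import ListNotations.
Local Open Scope R_scope.

(** * Scalar and vector products, lengths and collinearity *)

Definition dot (P Q S : point) : R :=
  (fst Q - fst P) * (fst S - fst P) + (snd Q - snd P) * (snd S - snd P).

Lemma seg_length_ge0 (P Q : point) : 0 <= seg_length P Q.
Proof. apply sqrt_pos. Qed.

Lemma sqr_inj (x y : R) : 0 <= x -> 0 <= y -> x ^ 2 = y ^ 2 -> x = y.
Proof. nra. Qed.

Lemma seg_length_sq (P Q : point) : seg_length P Q ^ 2 = dot P Q Q.
Proof.
unfold seg_length, dist_euc, dot.
rewrite pow2_sqrt; [unfold Rsqr; ring |].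
apply Rplus_le_le_0_compat; apply Rle_0_sqr.
Qed.

Lemma seg_length_eq (P Q : point) (r : R) :
  0 <= r -> dot P Q Q = r ^ 2 -> seg_length P Q = r.
Proof.
intros Hr H. assert (H0 := seg_length_ge0 P Q).
rewrite <- seg_length_sq in H. nra.
Qed.

Lemma seg_length_sym (P Q : point) : seg_length P Q = seg_length Q P.
Proof.
apply seg_length_eq; [apply seg_length_ge0 |].
rewrite seg_length_sq. unfold dot. ring.
Qed.

Lemma cross_rot (P Q S : point) : cross P Q S = cross Q S P.
Proof. unfold cross. ring. Qed.

Lemma cross_swap (P Q S : point) : cross Q P S = - cross P Q S.
Proof. unfold cross. ring. Qed.

Lemma lagrange_identity (P Q S : point) :
  cross P Q S ^ 2 + dot P Q S ^ 2 = dot P Q Q * dot P S S.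
Proof. unfold cross, dot. ring. Qed.

Lemma sum_sqr_eq0 (x y : R) : x ^ 2 + y ^ 2 = 0 -> x = 0 /\ y = 0.
Proof. intros H. split; nra. Qed.

Lemma cross_eq0_collinear (P Q S : point) : cross P Q S = 0 -> collinear P Q S.
Proof.
destruct P as [p1 p2], Q as [q1 q2], S as [s1 s2]; unfold cross; cbn; intros H.
destruct (Req_dec ((q1 - p1) ^ 2 + (q2 - p2) ^ 2) 0) as [E | N].
- apply sum_sqr_eq0 in E as [E1 E2]. left. f_equal; lra.
- right.
  (* This is the parameter of the foot of the perpendicular from S to the line PQ; by [H] the foot
     is S itself. *)
  exists (((q1 - p1) * (s1 - p1) + (q2 - p2) * (s2 - p2))
          / ((q1 - p1) ^ 2 + (q2 - p2) ^ 2)).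
  unfold point_at; cbn [fst snd]; f_equal; apply Rmult_eq_reg_r with (2 := N).
  + match goal with |- _ = ?z => replace z with (p1 * ((q1 - p1) ^ 2 + (q2 - p2) ^ 2)
      + ((q1 - p1) * (s1 - p1) + (q2 - p2) * (s2 - p2)) * (q1 - p1)) by (field; exact N) end.
    apply Rminus_diag_uniq.
    transitivity (- (q2 - p2) * ((q1 - p1) * (s2 - p2) - (q2 - p2) * (s1 - p1)));
      [ring | rewrite H; ring].
  + match goal with |- _ = ?z => replace z with (p2 * ((q1 - p1) ^ 2 + (q2 - p2) ^ 2)
      + ((q1 - p1) * (s1 - p1) + (q2 - p2) * (s2 - p2)) * (q2 - p2)) by (field; exact N) end.
    apply Rminus_diag_uniq.
    transitivity ((q1 - p1) * ((q1 - p1) * (s2 - p2) - (q2 - p2) * (s1 - p1)));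
      [ring | rewrite H; ring].
Qed.

Lemma cross_neq0 (P Q S : point) : ~ collinear P Q S -> cross P Q S <> 0.
Proof. intros H E. apply H. now apply cross_eq0_collinear. Qed.

Lemma cross_seg_length_gt0 (P Q S : point) : cross P Q S <> 0 -> 0 < seg_length P Q.
Proof.
intros H. destruct (seg_length_ge0 P Q) as [G | E]; [exact G |].
exfalso. apply H. assert (L := lagrange_identity P Q S).
rewrite <- (seg_length_sq P Q), <- E in L. nra.
Qed.

(** * Reflex corners of a simple quadrilateral *)

Lemma opposite_sides_meet (P Q S T : point) :
  cross P Q S * cross P Q T < 0 -> cross S T P * cross S T Q < 0 ->
  ~ no_common_interior_point P Q S T.
Proof.
assert (ratio : forall x y, x * y < 0 -> 0 < x / (x - y) < 1).
{ intros x y H.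
  assert (N : x - y <> 0) by nra.
  assert (D : 0 < / (x - y) ^ 2) by (apply Rinv_0_lt_compat; nra).
  replace (x / (x - y)) with ((x * (x - y)) * / (x - y) ^ 2) by (field; lra).
  assert (E : (x - y) ^ 2 * / (x - y) ^ 2 = 1) by (apply Rinv_r; nra).
  split; nra. }
intros H1 H2 N.
(* The function [cross S T] is affine along PQ with values of opposite signs at the ends, and this
   point is its zero. The parameter on ST below comes from [cross P Q] in the same way. *)
apply (N (point_at P Q (cross S T P / (cross S T P - cross S T Q)))).
split.
- eexists; split; [| reflexivity]. now apply ratio.
- exists (cross P Q S / (cross P Q S - cross P Q T)). split; [now apply ratio |].
  assert (N1 : cross P Q S - cross P Q T <> 0) by nra.
  assert (N2 : cross S T P - cross S T Q <> 0) by nra.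
  destruct P as [p1 p2], Q as [q1 q2], S as [s1 s2], T as [t1 t2].
  unfold cross, point_at in *; cbn in *; f_equal; field; split; lra.
Qed.

Lemma no_common_interior_point_sym (P Q S T : point) :
  no_common_interior_point P Q S T -> no_common_interior_point S T P Q.
Proof. unfold no_common_interior_point. intros H X [H1 H2]. now apply (H X). Qed.

(* The side AB would cross the side CO. *)
Lemma adjacent_reflex_corners (O A B C : point) :
  no_common_interior_point A B C O ->
  cross O A C < 0 -> cross A B O < 0 -> 0 < cross B C A -> 0 < cross C O B ->
  False.
Proof.
intros N H1 H2 H3 H4.
apply (opposite_sides_meet A B C O); [| | exact N].
- rewrite (cross_rot A B C). nra.
- rewrite (cross_rot C O A). nra.
Qed.

Lemma two_signed_area (O A B C : point) :
  2 * signed_area O A B C = cross O A C + cross B C A.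
Proof. unfold signed_area, cross. field. Qed.

(** Both sides are twice the signed area, cut along AC on the left and along OB on the right. *)
Lemma corner_crosses_sum (O A B C : point) :
  cross O A C + cross B C A = cross A B O + cross C O B.
Proof. unfold cross. ring. Qed.

Lemma corner_crosses_neq0 (O A B C : point) :
  quadrilateral O A B C ->
  cross O A C <> 0 /\ cross A B O <> 0 /\ cross B C A <> 0 /\ cross C O B <> 0.
Proof.
intros (H1 & H2 & H3 & H4 & _).
repeat split.
- rewrite <- cross_rot. now apply cross_neq0.
- rewrite <- cross_rot. now apply cross_neq0.
- rewrite <- cross_rot. now apply cross_neq0.
- rewrite <- cross_rot. now apply cross_neq0.
Qed.

(** If two neighbouring crosses were negative, the positive area, cut along either diagonal, would
    make the other two positive, and two opposite sides would cross. *)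
Lemma at_most_one_reflex (O A B C : point) :
  quadrilateral O A B C -> counterclockwise O A B C ->
  (0 < cross O A C \/ 0 < cross A B O) /\ (0 < cross A B O \/ 0 < cross B C A) /\
  (0 < cross B C A \/ 0 < cross C O B) /\ (0 < cross C O B \/ 0 < cross O A C).
Proof.
intros Hq Hc.
destruct (corner_crosses_neq0 _ _ _ _ Hq) as (N1 & N2 & N3 & N4).
destruct Hq as (_ & _ & _ & _ & _ & S1 & _ & _ & S2 & _).
unfold counterclockwise in Hc. assert (E := two_signed_area O A B C).
assert (E' := corner_crosses_sum O A B C).
assert (S1' := no_common_interior_point_sym _ _ _ _ S1).
assert (S2' := no_common_interior_point_sym _ _ _ _ S2).
repeat split; apply NNPP; intros F; apply not_or_and in F; destruct F as [F1 F2].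
- apply (adjacent_reflex_corners O A B C); trivial; lra.
- apply (adjacent_reflex_corners A B C O); trivial; lra.
- apply (adjacent_reflex_corners B C O A); trivial; lra.
- apply (adjacent_reflex_corners C O A B); trivial; lra.
Qed.

(** * The enclosed region and its convexity *)

Lemma in_triangle_rot (P Q S X : point) : in_triangle P Q S X -> in_triangle Q S P X.
Proof.
intros (u & v & w & Hu & Hv & Hw & E & EX). exists v, w, u.
repeat split; try lra. rewrite EX. f_equal; ring.
Qed.

Lemma region_rot (O A B C X : point) : region O A B C X -> region A B C O X.
Proof.
unfold region, line_separates. intros [[S H] | [S H]]; [right | left]; split.
- rewrite 2!(cross_swap O B). lra.
- destruct H as [H | H]; [right | left].
  + now do 2 apply in_triangle_rot.
  + now apply in_triangle_rot.
- lra.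
- exact H.
Qed.

Lemma convex_rot (O A B C : point) : convex O A B C -> convex A B C O.
Proof.
intros H X Y Z HX HY HZ.
apply region_rot. apply (H X Y Z); [ | | exact HZ];
  do 3 apply region_rot; assumption.
Qed.

Lemma cross_combination (P Q A B C : point) (u v w : R) :
  u + v + w = 1 ->
  cross P Q (u * fst A + v * fst B + w * fst C, u * snd A + v * snd B + w * snd C)
  = u * cross P Q A + v * cross P Q B + w * cross P Q C.
Proof.
intros E. replace u with (1 - v - w) by lra. unfold cross; cbn; ring.
Qed.

Lemma cross_in_triangle_ge0 (P Q A B C X : point) :
  0 <= cross P Q A -> 0 <= cross P Q B -> 0 <= cross P Q C ->
  in_triangle A B C X -> 0 <= cross P Q X.
Proof.
intros HA HB HC (u & v & w & Hu & Hv & Hw & E & ->).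
rewrite cross_combination; trivial. nra.
Qed.

Lemma cross_diag (P Q : point) : cross P Q Q = 0.
Proof. unfold cross; ring. Qed.

Lemma cross_base (P Q : point) : cross P Q P = 0.
Proof. unfold cross; ring. Qed.

Lemma cross_point_at (P Q X Y : point) (t : R) :
  cross P Q (point_at X Y t) = (1 - t) * cross P Q X + t * cross P Q Y.
Proof. unfold cross, point_at; cbn; ring. Qed.

(** O and B lie strictly on the same side of the line AC, so the triangles OAB and OBC meet this
    line only in A and C. The midpoint of AC is therefore outside the region, although A and C
    belong to it. *)
Lemma reflex_not_convex (O A B C : point) :
  cross O A C < 0 -> 0 < cross A B O -> 0 < cross B C A -> 0 < cross C O B ->
  ~ convex O A B C.
Proof.
intros HO HA HB HC Hcv.
assert (sepOB : line_separates O B A C).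
{ unfold line_separates.
  rewrite (cross_swap B O A), <- (cross_rot A B O), (cross_rot O B C), (cross_rot B C O).
  nra. }
assert (inA : region O A B C A).
{ left; split; [exact sepOB | left]. exists 0, 1, 0.
  repeat split; try lra. destruct A; cbn; f_equal; ring. }
assert (inC : region O A B C C).
{ left; split; [exact sepOB | right]. exists 0, 0, 1.
  repeat split; try lra. destruct C; cbn; f_equal; ring. }
assert (inM : region O A B C (point_at A C (/ 2))).
{ apply (Hcv A C); trivial. exists (/ 2). split; [lra | reflexivity]. }
assert (neqAC : forall t, t <> 0 -> point_at A C (/ 2) <> point_at A C (/ 2 + t)).
{ intros t Ht E. assert (A = C) as <-.
  { destruct A as [a1 a2], C as [c1 c2]. unfold point_at in E; cbn in E.
    injection E as E1 E2. f_equal; nra. }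
  rewrite cross_diag in HO. lra. }
assert (EM : cross A C (point_at A C (/ 2)) = 0).
{ rewrite cross_point_at, cross_diag, cross_base. ring. }
assert (WO : cross A C O < 0) by (now rewrite <- cross_rot).
assert (WB : cross A C B < 0) by (rewrite cross_swap, <- (cross_rot B C A); lra).
destruct inM as [[_ [H | H]] | [S _]].
- destruct H as (u & v & w & Hu & Hv & Hw & E & EX).
  rewrite EX, cross_combination, cross_base in EM by exact E.
  assert (u = 0) by nra. assert (w = 0) by nra. subst u w.
  apply (neqAC (- / 2)); [lra |]. rewrite EX.
  replace v with 1 by lra. unfold point_at. f_equal; field.
- destruct H as (u & v & w & Hu & Hv & Hw & E & EX).
  rewrite EX, cross_combination, cross_diag in EM by exact E.
  assert (u = 0) by nra. assert (v = 0) by nra. subst u v.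
  apply (neqAC (/ 2)); [lra |]. rewrite EX.
  replace w with 1 by lra. unfold point_at. f_equal; field.
- unfold line_separates in S. nra.
Qed.

(** Every triangle in the definition of the region lies to the left of OA and meets the line only
    within the side. This places the points of tangency at the two sides through O on the sides
    themselves, in the concave case too. *)
Lemma region_side (O A B C X : point) :
  0 < cross O A B -> 0 < cross O A C -> region O A B C X ->
  0 <= cross O A X /\ (cross O A X = 0 -> on_segment O A X).
Proof.
intros HB HC HX; split.
- destruct HX as [[_ [H | H]] | [_ [H | H]]];
    apply cross_in_triangle_ge0 with (4 := H);
      rewrite ?cross_diag, ?cross_base; lra.
- intros E.
  destruct HX as [[_ [H | H]] | [_ [H | H]]];
    destruct H as (u & v & w & Hu & Hv & Hw & E1 & EX); subst X;
    rewrite cross_combination, ?cross_diag, ?cross_base in E by exact E1;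
    [exists v | exists 0 | exists 1 | exists u]; split; try nra.
  + assert (w = 0) by nra. subst w. replace u with (1 - v) by lra.
    unfold point_at. f_equal; ring.
  + assert (v = 0) by nra. assert (w = 0) by nra. subst v w. replace u with 1 by lra.
    unfold point_at. f_equal; ring.
  + assert (v = 0) by nra. assert (w = 0) by nra. subst v w. replace u with 1 by lra.
    unfold point_at. f_equal; ring.
  + assert (v = 0) by nra. subst v. replace w with (1 - u) by lra.
    unfold point_at. f_equal; ring.
Qed.

(** * Tangent lines, position of the incenter and tangent lengths *)

Lemma tangent_at_foot (I : point) (r : R) (P Q T : point) :
  0 < seg_length P Q -> tangent_at I r P Q T ->
  on_line P Q T /\ seg_length I T = r /\
  (fst T - fst I) * (fst Q - fst P) + (snd T - snd I) * (snd Q - snd P) = 0.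
Proof.
intros Hl Ht.
destruct (proj2 (Ht T) eq_refl) as [[t ET] ER].
split; [now exists t |]. split; [exact ER |].
assert (Hd : 0 < dot P Q Q) by (rewrite <- seg_length_sq; nra).
set (k := (fst T - fst I) * (fst Q - fst P) + (snd T - snd I) * (snd Q - snd P)).
(* the mirror image of T in the foot of the perpendicular from I *)
set (X := point_at P Q (t - 2 * k / dot P Q Q)).
assert (EX : X = T).
{ apply Ht. split; [now eexists |].
  rewrite <- ER. apply seg_length_eq; [apply seg_length_ge0 |].
  rewrite seg_length_sq. unfold X.
  assert (Hd' : dot P Q Q <> 0) by lra. revert Hd'.
  unfold k, X. rewrite ET.
  destruct P as [p1 p2], Q as [q1 q2], I as [i1 i2].
  unfold dot, point_at; cbn. intros Hd'. field. exact Hd'. }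
assert (Ek : k * dot P Q Q = 0).
{ set (y := 2 * k / dot P Q Q) in *.
  assert (Ey : y * dot P Q Q = 2 * k) by (unfold y; field; lra).
  assert (E1 : y * (fst Q - fst P) = 0 /\ y * (snd Q - snd P) = 0).
  { unfold X in EX. rewrite ET in EX. unfold point_at in EX. injection EX as E1 E2. split; lra. }
  destruct E1 as [E1 E2].
  assert (y * dot P Q Q = 0).
  { unfold dot. rewrite Rmult_plus_distr_l, <- !Rmult_assoc, E1, E2. ring. }
  nra. }
apply Rmult_integral in Ek. destruct Ek; lra.
Qed.

(** The distance from the centre to a tangent is the radius. The squares leave open on which side of
    the line the centre lies. *)
Lemma tangent_at_cross (I : point) (r : R) (P Q T : point) :
  0 < seg_length P Q -> tangent_at I r P Q T ->
  cross P Q I ^ 2 = (r * seg_length P Q) ^ 2.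
Proof.
intros Hl Ht.
destruct (tangent_at_foot _ _ _ _ _ Hl Ht) as ([t ET] & ER & Ed).
rewrite Rpow_mult_distr, <- ER, 2!seg_length_sq. rewrite ET in *.
destruct P as [p1 p2], Q as [q1 q2], I as [i1 i2].
unfold dot, cross, point_at in *; cbn in *.
(* By Lagrange's identity the two sides differ by the square of the scalar product that vanishes by
   [Ed]. *)
match type of Ed with ?x = 0 =>
  match goal with |- ?l = ?m =>
    enough (m - l = x ^ 2) by (rewrite Ed in *; lra) end end.
ring.
Qed.

(* A circle touching the side PQ of a triangle PQS at a point of the side, and
   touching the line QS, lies on the same side of QS as P: otherwise it would
   touch both lines at Q. *)
Lemma tangent_next_side (I : point) (r : R) (P Q S T : point) (t : R) :
  0 < r -> 0 <= t <= 1 -> T = point_at P Q t -> seg_length I T = r ->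
  (fst T - fst I) * (fst Q - fst P) + (snd T - snd I) * (snd Q - snd P) = 0 ->
  cross Q S P <> 0 -> cross Q S I ^ 2 = (r * seg_length Q S) ^ 2 ->
  0 < cross Q S I * cross Q S P.
Proof.
intros Hr Ht ET ER Ed Hk Em.
assert (HQS : 0 < seg_length Q S) by now apply (cross_seg_length_gt0 Q S P).
apply Rnot_le_lt; intros Hle.
assert (Hr2 : dot I T T = r ^ 2) by now rewrite <- seg_length_sq, ER.
assert (HT : cross Q S T = (1 - t) * cross Q S P)
  by (rewrite ET, cross_point_at, cross_base; ring).
rewrite Rpow_mult_distr, seg_length_sq, <- Hr2 in Em.
(* Up to the factor QS, [n] and [o] are the components of the radius IT normal to QS and along
   QS. *)
set (n := cross Q S T - cross Q S I).
set (o := (fst S - fst Q) * (fst T - fst I) + (snd S - snd Q) * (snd T - snd I)).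
assert (En : n ^ 2 + o ^ 2 = cross Q S I ^ 2).
{ rewrite Em. unfold n, o, cross, dot. ring. }
assert (Hm : 0 < cross Q S I ^ 2).
{ rewrite Em, Hr2, <- seg_length_sq. apply Rmult_lt_0_compat; nra. }
set (m := cross Q S I) in *. set (k := cross Q S P) in *.
assert (Hmk : m * k < 0).
{ assert (m <> 0) by nra. assert (m * k <> 0) by now apply Rmult_integral_contrapositive. lra. }
(* Since [m] and [k] have opposite signs, the absolute value of [n = (1 - t) * k - m] would exceed
   that of [m] for [t < 1], against [En]. *)
assert (Ht1 : t = 1).
{ assert (Hn : n = (1 - t) * k - m) by (unfold n; rewrite HT; reflexivity).
  assert (0 <= o ^ 2) by apply pow2_ge_0.
  assert ((1 - t) * (k ^ 2 * (1 - t) - 2 * (m * k)) <= 0).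
  { replace ((1 - t) * (k ^ 2 * (1 - t) - 2 * (m * k))) with (((1 - t) * k - m) ^ 2 - m ^ 2) by ring.
    rewrite <- Hn. lra. }
  assert (0 < k ^ 2) by nra.
  apply Rle_antisym; [lra |]. apply Rnot_lt_le; intros Hlt.
  assert (0 <= k ^ 2 * (1 - t)) by (apply Rmult_le_pos; lra). nra. }
assert (Eo : o = 0).
{ assert (En' : n = - m) by (unfold n; rewrite HT, Ht1; lra). rewrite En' in En.
  assert (o ^ 2 = 0) by lra. nra. }
(* The radius IT is now orthogonal to both PQ and QS, which are independent because [k] is nonzero;
   by Cramer's rule it vanishes, which contradicts [0 < r]. *)
assert (Hk2 : k * (fst T - fst I) = 0 /\ k * (snd T - snd I) = 0).
{ split.
  - transitivity ((snd S - snd Q) * ((fst T - fst I) * (fst Q - fst P)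
      + (snd T - snd I) * (snd Q - snd P)) - (snd Q - snd P) * o);
      [unfold k, o, cross; ring | rewrite Ed, Eo; ring].
  - transitivity ((fst Q - fst P) * o - (fst S - fst Q) * ((fst T - fst I) * (fst Q - fst P)
      + (snd T - snd I) * (snd Q - snd P)));
      [unfold k, o, cross; ring | rewrite Ed, Eo; ring]. }
destruct Hk2 as [E1 E2].
apply Rmult_integral in E1 as [E1 | E1]; [lra |].
apply Rmult_integral in E2 as [E2 | E2]; [lra |].
unfold dot in Hr2. rewrite E1, E2 in Hr2. nra.
Qed.

(** Tangency gives each cross up to sign. At the two sides through O the region settles the sign; at
    the two sides through B, where the corner may be reflex, [tangent_next_side] carries it over
    from the neighbouring side. *)
Lemma incenter_crosses (O A B C I : point) (r : R) :
  0 < cross O A C -> 0 < cross A B O -> cross B C A <> 0 -> 0 < cross C O B ->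
  incircle O A B C I r ->
  cross O A I = r * seg_length O A /\ cross A B I = r * seg_length A B /\
  cross B C I = r * seg_length B C /\ cross C O I = r * seg_length C O.
Proof.
intros HO HA HB HC (Hr & Hdisc & T1 & T2 & T3 & T4 & H1 & H2 & H3 & H4 & _).
assert (HA1 : 0 < cross O A B) by (now rewrite cross_rot).
assert (HC1 : 0 < cross B C O) by (now rewrite cross_rot).
assert (HO1 : 0 < cross C O A) by (now rewrite cross_rot).
assert (La : 0 < seg_length O A) by (apply (cross_seg_length_gt0 O A C); lra).
assert (Lb : 0 < seg_length A B) by (apply (cross_seg_length_gt0 A B O); lra).
assert (Lc : 0 < seg_length B C) by (apply (cross_seg_length_gt0 B C A); lra).
assert (Ld : 0 < seg_length C O) by (apply (cross_seg_length_gt0 C O B); lra).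
assert (E1 := tangent_at_cross _ _ _ _ _ La H1).
assert (E2 := tangent_at_cross _ _ _ _ _ Lb H2).
assert (E3 := tangent_at_cross _ _ _ _ _ Lc H3).
assert (E4 := tangent_at_cross _ _ _ _ _ Ld H4).
destruct (tangent_at_foot _ _ _ _ _ La H1) as ([t1 P1] & R1 & D1).
destruct (tangent_at_foot _ _ _ _ _ Ld H4) as ([t4 P4] & R4 & D4).
assert (II : region O A B C I).
{ apply Hdisc. rewrite (seg_length_eq I I 0); [lra | lra | unfold dot; ring]. }
assert (IT1 : region O A B C T1) by (apply Hdisc; lra).
assert (IT4 : region O A B C T4) by (apply Hdisc; lra).
assert (PO : 0 <= cross O A I) by now apply (region_side O A B C I).
assert (PC : 0 <= cross C O I).
{ apply (region_side C O A B I); trivial. now do 3 apply region_rot. }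
assert (S1 : on_segment O A T1).
{ apply (region_side O A B C T1); trivial.
  rewrite P1, cross_point_at, cross_diag, cross_base. ring. }
assert (S4 : on_segment C O T4).
{ apply (region_side C O A B T4); trivial.
  - now do 3 apply region_rot.
  - rewrite P4, cross_point_at, cross_diag, cross_base. ring. }
destruct S1 as (s1 & Hs1 & Q1). destruct S4 as (s4 & Hs4 & Q4).
assert (PA : 0 < cross A B I * cross A B O).
{ apply (tangent_next_side I r O A B T1 s1); trivial. lra. }
assert (PB : 0 < cross C B I * cross C B O).
(* The side CO is traversed from O to C here, so its parameter [s4] becomes [1 - s4]. *)
{ apply (tangent_next_side I r O C B T4 (1 - s4)); trivial.
  - lra.
  - rewrite Q4. unfold point_at. f_equal; ring.
  - lra.
  - rewrite cross_swap. lra.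
  - rewrite cross_swap, (seg_length_sym C B). lra. }
rewrite 2!(cross_swap B C) in PB.
assert (PA' : 0 < cross A B I) by nra.
assert (PB' : 0 < cross B C I).
{ replace (cross B C I) with (cross B C I * cross B C O * / cross B C O) by (field; lra).
  apply Rmult_lt_0_compat; [lra | now apply Rinv_0_lt_compat]. }
repeat split; apply sqr_inj; trivial; try lra; apply Rmult_le_pos; lra.
Qed.

(* [e] is the tangent length r cot (angle PQS / 2); it is negative at a reflex
   corner. *)
Lemma corner_tangent_length (I P Q S : point) (r : R) :
  0 < r -> cross Q S P <> 0 ->
  cross P Q I = r * seg_length P Q -> cross Q S I = r * seg_length Q S ->
  exists e : R,
    dot Q P I = e * seg_length P Q /\ dot Q S I = e * seg_length Q S /\
    0 < e * cross Q S P /\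
    cross Q S P * (e ^ 2 + r ^ 2) = 2 * r * seg_length P Q * seg_length Q S * e /\
    cross Q S P * (e ^ 2 - r ^ 2) = 2 * r * dot Q P S * e.
Proof.
intros Hr HV HP HS.
assert (Lm : 0 < seg_length Q S) by now apply (cross_seg_length_gt0 Q S P).
assert (Ll : 0 < seg_length P Q).
{ apply (cross_seg_length_gt0 P Q S). now rewrite cross_rot. }
assert (El : seg_length P Q ^ 2 = dot Q P P)
  by (rewrite seg_length_sq; unfold dot; ring).
assert (Em := seg_length_sq Q S).
assert (EL := lagrange_identity Q S P). rewrite <- El, <- Em in EL.
replace (dot Q S P) with (dot Q P S) in EL by (unfold dot; ring).
set (l := seg_length P Q) in *. set (m := seg_length Q S) in *.
set (V := cross Q S P) in *.
assert (Ei : V * dot Q P I = r * l * dot Q P S + r * m * dot Q P P /\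
             V * dot Q S I = r * l * dot Q S S + r * m * dot Q P S).
{ rewrite <- HP, <- HS. unfold V, cross, dot. split; ring. }
destruct Ei as [Ei1 Ei2]. rewrite <- El in Ei1. rewrite <- Em in Ei2.
set (D := dot Q P S) in *.
(* With [D = l m cos] and [V = l m sin] of the corner angle, this is [r (1 + cos) / sin], that is
   [r] times the cotangent of the half-angle. *)
exists (r * (l * m + D) / V).
(* Lagrange's identity with [V] nonzero makes [D ^ 2] smaller than [(l * m) ^ 2]. *)
assert (HD : 0 < l * m + D).
{ assert (0 < V ^ 2) by nra. assert (0 < l * m) by nra. nra. }
repeat split.
- apply Rmult_eq_reg_l with V; trivial. rewrite Ei1. field; trivial.
- apply Rmult_eq_reg_l with V; trivial. rewrite Ei2. field; trivial.
- replace (r * (l * m + D) / V * V) with (r * (l * m + D)) by (field; trivial). nra.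
- apply Rmult_eq_reg_l with V; trivial.
  replace (V * (V * ((r * (l * m + D) / V) ^ 2 + r ^ 2)))
    with (r ^ 2 * ((l * m + D) ^ 2 + V ^ 2)) by (field; trivial).
  replace (V ^ 2) with (m ^ 2 * l ^ 2 - D ^ 2) by lra. field; trivial.
- apply Rmult_eq_reg_l with V; trivial.
  replace (V * (V * ((r * (l * m + D) / V) ^ 2 - r ^ 2)))
    with (r ^ 2 * ((l * m + D) ^ 2 - V ^ 2)) by (field; trivial).
  replace (V ^ 2) with (m ^ 2 * l ^ 2 - D ^ 2) by lra. field; trivial.
Qed.

(** * The circumcircle criterion and the algebra of the tangent lengths *)

Lemma within_circumcircle_iff (O A B C : point) :
  0 < cross O A C ->
  (within_circumcircle O A C B <->
   cross O A C * dot B A C + cross B C A * dot O A C < 0).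
Proof.
intros HW.
(* The crosses are the coefficients of the affine dependence between B, O, A, C. They sum to 0, so
   the weighted sum of squared distances to Z does not depend on Z; at the circumcenter of OAC it is
   [cross O A C] times the power of B. *)
assert (power : forall Z, cross O A C * dot B A C + cross B C A * dot O A C =
  cross O A C * dot Z B B + cross B C A * dot Z O O
  - cross C O B * dot Z A A - cross A B O * dot Z C C)
  by (intros; unfold cross, dot; ring).
assert (sum : forall rho2, cross B C A * rho2 - cross C O B * rho2 - cross A B O * rho2
  = - cross O A C * rho2) by (intros; unfold cross; ring).
split.
- intros (Z & rho & EO & EA & EC & HB).
  assert (HB0 := seg_length_ge0 Z B). assert (EB := seg_length_sq Z B).
  rewrite (power Z), <- !seg_length_sq, EO, EA, EC.
  assert (E := sum (rho ^ 2)).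
  assert (seg_length Z B ^ 2 < rho ^ 2) by nra. nra.
- intros Hneg.
  destruct O as [o1 o2], A as [a1 a2], C as [c1 c2].
  set (W := cross (o1, o2) (a1, a2) (c1, c2)) in *.
  set (u := (a1 - o1) ^ 2 + (a2 - o2) ^ 2). set (v := (c1 - o1) ^ 2 + (c2 - o2) ^ 2).
  (* The circumcenter, by Cramer's rule from the equations of two perpendicular bisectors. *)
  set (Z := (o1 + (u * (c2 - o2) - v * (a2 - o2)) / (2 * W),
             o2 + (v * (a1 - o1) - u * (c1 - o1)) / (2 * W))).
  assert (HW' : W <> 0) by lra.
  assert (EA : dot Z (a1, a2) (a1, a2) = dot Z (o1, o2) (o1, o2)).
  { revert HW'. unfold Z, u, v, W, dot, cross; cbn [fst snd]. intros. field; trivial. }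
  assert (EC : dot Z (c1, c2) (c1, c2) = dot Z (o1, o2) (o1, o2)).
  { revert HW'. unfold Z, u, v, W, dot, cross; cbn [fst snd]. intros. field; trivial. }
  exists Z, (seg_length Z (o1, o2)).
  assert (H0 := seg_length_ge0 Z (o1, o2)). assert (EO := seg_length_sq Z (o1, o2)).
  split; [reflexivity |].
  split; [apply seg_length_eq; congruence |].
  split; [apply seg_length_eq; congruence |].
  rewrite (power Z), EA, EC in Hneg.
  assert (E := sum (dot Z (o1, o2) (o1, o2))).
  rewrite <- (seg_length_sq Z (o1, o2)) in *. rewrite <- (seg_length_sq Z B) in *.
  fold W in E.
  assert (W * seg_length Z B ^ 2 < W * seg_length Z (o1, o2) ^ 2) by lra.
  apply Rmult_lt_reg_l in H; [| exact HW].
  assert (HB0 := seg_length_ge0 Z B). nra.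
Qed.

(* The half-angles have cotangents e/2, f/2, g/2, h/2 and add up to pi. *)
Lemma tangent_lengths_relation (e f g h U V : R) :
  0 < f -> 0 < h ->
  U * (f ^ 2 + 2 ^ 2) = 2 * 2 * (e + f) * (f + g) * f ->
  V * (h ^ 2 + 2 ^ 2) = 2 * 2 * (g + h) * (h + e) * h ->
  U + V = 4 * (e + f + g + h) ->
  4 * (e + f + g + h) = e * g * (f + h) + f * h * (e + g).
Proof.
intros Hf Hh HU HV Hs.
(* Eliminating [U] and [V] over the common denominator yields the relation times the positive factor
   [f * h + 4]. *)
assert (E : 4 * (f * h + 4) * (e * g * (f + h) + f * h * (e + g) - 4 * (e + f + g + h)) = 0).
{ transitivity ((h ^ 2 + 4) * (2 * 2 * (e + f) * (f + g) * f)
    + (f ^ 2 + 4) * (2 * 2 * (g + h) * (h + e) * h)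
    - 4 * (e + f + g + h) * (f ^ 2 + 4) * (h ^ 2 + 4)); [ring |].
  rewrite <- HU, <- HV, <- Hs. ring. }
apply Rmult_integral in E as [E | E]; [| lra].
assert (0 < f * h) by now apply Rmult_lt_0_compat. lra.
Qed.

Lemma pos_mul (x y : R) : 0 < x -> 0 < x * y -> 0 < y.
Proof. nra. Qed.

(** This replaces the geometry by four real numbers: sides, angles, convexity and the circumcircle
    test are all expressed in tangent lengths, with the sign of [g] telling whether B is reflex. *)
Lemma tangential_leq_sides (O A B C : point) :
  LEQ O A B C -> tangential O A B C -> counterclockwise O A B C ->
  (~ convex O A B C -> reflex_at A B C) ->
  exists e f g h : R,
    0 < e /\ 0 < f /\ 0 < h /\ g <> 0 /\ (convex O A B C <-> 0 < g) /\
    seg_length O A = e + f /\ seg_length A B = f + g /\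
    seg_length B C = g + h /\ seg_length C O = h + e /\
    4 * (e + f + g + h) = e * g * (f + h) + f * h * (e + g) /\
    0 < e + g /\
    dot O A C * (e + g) = (e + f + g + h) * (e ^ 2 - 4) /\
    dot A O B * (f + h) = (e + f + g + h) * (f ^ 2 - 4) /\
    (within_circumcircle O A C B <-> e * g < 4).
Proof.
intros (Hq & _ & _ & _ & _ & Harea) (I & r & Hinc) Hccw Hreflex.
destruct (corner_crosses_neq0 _ _ _ _ Hq) as (NO & NA & NB & NC).
destruct (at_most_one_reflex _ _ _ _ Hq Hccw) as (M1 & M2 & M3 & M4).
assert (E2s := two_signed_area O A B C).
assert (Esum := corner_crosses_sum O A B C).
unfold counterclockwise in Hccw.
assert (signs : 0 < cross O A C /\ 0 < cross A B O /\ 0 < cross C O B /\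
                (convex O A B C <-> 0 < cross B C A)).
(* If B is not reflex, the hypothesis makes the region convex, which excludes a reflex corner
   elsewhere. If B is reflex, its neighbours are not, and the positive area takes care of O. *)
{ destruct (Rlt_le_dec 0 (cross B C A)) as [HB | HB].
  - assert (Hcv : convex O A B C).
    { apply NNPP; intros H. apply Hreflex in H. unfold reflex_at in H. lra. }
    repeat split; trivial.
    + apply Rnot_le_lt; intros H. apply (reflex_not_convex O A B C); trivial; lra.
    + apply Rnot_le_lt; intros H.
      apply (reflex_not_convex A B C O); try lra. now apply convex_rot.
    + apply Rnot_le_lt; intros H.
      apply (reflex_not_convex C O A B); try lra. now do 3 apply convex_rot.
  - assert (cross B C A < 0) by lra. repeat split; try lra.
    intros H'. exfalso.
    apply (reflex_not_convex B C O A); try lra. now do 2 apply convex_rot. }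
destruct signs as (HO & HA & HC & Hcv).
destruct (incenter_crosses O A B C I r HO HA NB HC Hinc) as (I1 & I2 & I3 & I4).
assert (Hr : 0 < r) by apply Hinc.
(* The triangles from I over the four sides add up to the area, which is thus [r / 2] times the
   perimeter. *)
assert (Er : r = 2).
{ unfold area, perimeter in Harea. rewrite Rabs_right in Harea by lra.
  assert (cross O A I + cross A B I + cross B C I + cross C O I = 2 * signed_area O A B C)
    by (unfold cross, signed_area; field).
  rewrite I1, I2, I3, I4, Harea in *.
  set (p := seg_length O A + seg_length A B + seg_length B C + seg_length C O) in *.
  apply Rmult_eq_reg_r with p; [rewrite <- H; unfold p; ring | lra]. }
subst r.
assert (L1 : 0 < seg_length O A) by (apply (cross_seg_length_gt0 O A C); lra).
assert (L2 : 0 < seg_length A B) by (apply (cross_seg_length_gt0 A B O); lra).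
assert (L3 : 0 < seg_length B C) by (apply (cross_seg_length_gt0 B C A); lra).
assert (L4 : 0 < seg_length C O) by (apply (cross_seg_length_gt0 C O B); lra).
destruct (corner_tangent_length I C O A 2 Hr NO I4 I1) as (e & e1 & e2 & e3 & e4 & e5).
destruct (corner_tangent_length I O A B 2 Hr NA I1 I2) as (f & f1 & f2 & f3 & f4 & f5).
destruct (corner_tangent_length I A B C 2 Hr NB I2 I3) as (g & g1 & g2 & g3 & g4 & g5).
destruct (corner_tangent_length I B C O 2 Hr NC I3 I4) as (h & h1 & h2 & h3 & h4 & h5).
assert (He : 0 < e) by (apply pos_mul with (cross O A C); lra).
assert (Hf : 0 < f) by (apply pos_mul with (cross A B O); lra).
assert (Hh : 0 < h) by (apply pos_mul with (cross C O B); lra).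
assert (side : forall P Q x y, 0 < seg_length P Q ->
  dot P Q I = x * seg_length P Q -> dot Q P I = y * seg_length P Q ->
  seg_length P Q = x + y).
{ intros P Q x y L Ex Ey. apply Rmult_eq_reg_r with (seg_length P Q); [| lra].
  transitivity (dot P Q Q); [rewrite <- seg_length_sq; ring |].
  rewrite Rmult_plus_distr_r, <- Ex, <- Ey. unfold dot; ring. }
assert (Ea := side _ _ _ _ L1 e2 f1). assert (Eb := side _ _ _ _ L2 f2 g1).
assert (Ec := side _ _ _ _ L3 g2 h1). assert (Ed := side _ _ _ _ L4 h2 e1).
assert (Harea' : cross O A C + cross B C A = 4 * (e + f + g + h)).
{ unfold area, perimeter in Harea. rewrite Rabs_right in Harea by lra. lra. }
assert (HR : 4 * (e + f + g + h) = e * g * (f + h) + f * h * (e + g)).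
{ apply (tangent_lengths_relation e f g h (cross A B O) (cross C O B)); trivial.
  - rewrite <- Ea, <- Eb. exact f4.
  - rewrite <- Ec, <- Ed. exact h4.
  - lra. }
assert (Hs : 0 < e + f + g + h) by lra.
assert (ad : (e ^ 2 + 4) * (e + f + g + h) = (e + f) * (h + e) * (e + g))
  by (rewrite Rmult_plus_distr_r, HR; ring).
assert (ab : (f ^ 2 + 4) * (e + f + g + h) = (e + f) * (f + g) * (f + h))
  by (rewrite Rmult_plus_distr_r, HR; ring).
assert (bc : (g ^ 2 + 4) * (e + f + g + h) = (f + g) * (g + h) * (e + g))
  by (rewrite Rmult_plus_distr_r, HR; ring).
assert (HX : 0 < e + g).
{ assert (0 < (e + f) * (h + e)) by (apply Rmult_lt_0_compat; lra).
  assert (0 < (e ^ 2 + 4) * (e + f + g + h)) by (apply Rmult_lt_0_compat; nra).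
  apply pos_mul with ((e + f) * (h + e)); lra. }
(* At a corner, [K] and [D] are the vector and scalar products, [x] the tangent length, [k] the
   product of the two sides and [X] the sum of [x] and the opposite tangent length. *)
assert (corner : forall K D x X k, x <> 0 -> 0 < k -> 0 < e + f + g + h ->
  K * (x ^ 2 + 2 ^ 2) = 2 * 2 * k * x -> K * (x ^ 2 - 2 ^ 2) = 2 * 2 * D * x ->
  (x ^ 2 + 4) * (e + f + g + h) = k * X ->
  K * X = 4 * x * (e + f + g + h) /\ D * X = (e + f + g + h) * (x ^ 2 - 4)).
{ intros K D x X k Hx Hk Hs' E1 E2 E3.
  assert (E : K * X = 4 * x * (e + f + g + h)).
  { apply Rmult_eq_reg_l with k; [| lra].
    transitivity (K * (k * X)); [ring |]. rewrite <- E3.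
    transitivity ((K * (x ^ 2 + 2 ^ 2)) * (e + f + g + h)); [ring |].
    rewrite E1. ring. }
  split; [exact E |].
  apply Rmult_eq_reg_l with (2 * 2 * x); [| lra].
  transitivity ((2 * 2 * D * x) * X); [ring |]. rewrite <- E2.
  transitivity ((K * X) * (x ^ 2 - 2 ^ 2)); [ring |]. rewrite E. ring. }
assert (Hg : g <> 0) by (intros ->; lra).
destruct (corner (cross O A C) (dot O C A) e (e + g) ((e + f) * (h + e))) as [WO DO];
  trivial; try lra; try (apply Rmult_lt_0_compat; lra).
{ rewrite e4, Ea, Ed. ring. }
destruct (corner (cross A B O) (dot A O B) f (f + h) ((e + f) * (f + g))) as [WA DA];
  trivial; try lra; try (apply Rmult_lt_0_compat; lra).
{ rewrite f4, Ea, Eb. ring. }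
destruct (corner (cross B C A) (dot B A C) g (e + g) ((f + g) * (g + h))) as [WB DB];
  trivial; try lra; try (apply Rmult_lt_0_compat; lra).
{ rewrite g4, Eb, Ec. ring. }
replace (dot O C A) with (dot O A C) in DO by (unfold dot; ring).
(* The circumcircle criterion, up to positive factors, becomes the sign of [e * g - 4]. *)
assert (EP : (cross O A C * dot B A C + cross B C A * dot O A C) * (e + g) ^ 2
  = 4 * (e + f + g + h) ^ 2 * (e + g) * (e * g - 4)).
{ transitivity ((cross O A C * (e + g)) * (dot B A C * (e + g))
    + (cross B C A * (e + g)) * (dot O A C * (e + g))); [ring |].
  rewrite WO, WB, DO, DB. ring. }
assert (HX2 : 0 < (e + g) ^ 2) by now apply pow_lt.
assert (HsX : 0 < 4 * (e + f + g + h) ^ 2 * (e + g)).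
{ assert (0 < (e + f + g + h) ^ 2) by now apply pow_lt. apply Rmult_lt_0_compat; lra. }
exists e, f, g, h. repeat split; trivial; try lra.
- intros H. apply Hcv in H. apply pos_mul with (cross B C A); lra.
- intros H. apply Hcv. apply pos_mul with g; lra.
- rewrite within_circumcircle_iff by exact HO. intros H.
  apply Rnot_le_lt; intros H'.
  assert (0 <= 4 * (e + f + g + h) ^ 2 * (e + g) * (e * g - 4)) by (apply Rmult_le_pos; lra).
  apply (Rmult_lt_compat_r _ _ _ HX2) in H. lra.
- rewrite within_circumcircle_iff by exact HO. intros H.
  apply Rmult_lt_reg_r with (1 := HX2). rewrite EP, Rmult_0_l.
  assert (0 < 4 * (e + f + g + h) ^ 2 * (e + g) * (4 - e * g)) by (apply Rmult_lt_0_compat; lra).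
  lra.
Qed.

(** The radicand is the square of [s (4 - e g) / (e + g)], with [s] the sum of the tangent lengths,
    and [dlt] supplies the sign lost by the root. As [a - b = e - g] and [a - d = f - h], both
    denominators then cancel. *)
Lemma sigma_tau_values (e f g h : R) :
  0 < f -> 0 < h -> 0 < e + g ->
  4 * (e + f + g + h) = e * g * (f + h) + f * h * (e + g) ->
  forall dlt : R, (dlt = 1 /\ e * g < 4 \/ dlt = -1 /\ 4 <= e * g) ->
  let a := e + f in let b := f + g in let c := g + h in let d := h + e in
  let S := sqrt (a * b * c * d - 4 * (a + c) ^ 2) in
  (a * d + b * c + 2 * dlt * S) / (16 + (a - b) ^ 2) = (a + c) / (e + g) /\
  (a * b + c * d - 2 * dlt * S) / (16 + (a - d) ^ 2) = (a + c) / (f + h).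
Proof.
intros Hf Hh HX HR dlt Hd a b c d S.
set (s := e + f + g + h).
assert (Hs : 0 < s) by (unfold s; lra).
assert (HY : 0 < f + h) by lra.
assert (ad : (e ^ 2 + 4) * s = a * d * (e + g))
  by (unfold s, a, d; rewrite Rmult_plus_distr_r, HR; ring).
assert (bc : (g ^ 2 + 4) * s = b * c * (e + g))
  by (unfold s, b, c; rewrite Rmult_plus_distr_r, HR; ring).
assert (ab : (f ^ 2 + 4) * s = a * b * (f + h))
  by (unfold s, a, b; rewrite Rmult_plus_distr_r, HR; ring).
assert (cd : (h ^ 2 + 4) * s = c * d * (f + h))
  by (unfold s, c, d; rewrite Rmult_plus_distr_r, HR; ring).
assert (ES : dlt * S = s * (4 - e * g) / (e + g)).
{ assert (E : a * b * c * d - 4 * (a + c) ^ 2 = (s * (4 - e * g) / (e + g)) ^ 2).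
  { apply Rmult_eq_reg_r with ((e + g) ^ 2); [| nra].
    transitivity ((a * d * (e + g)) * (b * c * (e + g)) - 4 * s ^ 2 * (e + g) ^ 2);
      [unfold s, a, c; ring |].
    rewrite <- ad, <- bc. field. lra. }
  assert (HsX : 0 < s / (e + g)) by now apply Rdiv_lt_0_compat.
  unfold S. rewrite E.
  replace (s * (4 - e * g) / (e + g)) with (s / (e + g) * (4 - e * g)) by (field; lra).
  destruct Hd as [[-> Hd] | [-> Hd]].
  - rewrite sqrt_pow2; [ring | apply Rmult_le_pos; lra].
  - replace ((s / (e + g) * (4 - e * g)) ^ 2) with ((s / (e + g) * (e * g - 4)) ^ 2) by ring.
    rewrite sqrt_pow2; [ring | apply Rmult_le_pos; lra]. }
(* The relation between the tangent lengths turns the root into an expression in [f] and [h], of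
   opposite form, which explains the minus sign in tau. *)
assert (EQ : (4 - e * g) / (e + g) = (f * h - 4) / (f + h)).
{ apply Rmult_eq_reg_r with ((e + g) * (f + h)); [| nra].
  transitivity ((4 - e * g) * (f + h)); [field; lra |].
  transitivity ((f * h - 4) * (e + g)); [lra | field; lra]. }
assert (Ea : a + c = s) by (unfold a, c, s; ring).
rewrite !Rmult_assoc, ES, Ea.
assert (H1 : 0 < 16 + (a - b) ^ 2) by (assert (0 <= (a - b) ^ 2) by apply pow2_ge_0; lra).
assert (H2 : 0 < 16 + (a - d) ^ 2) by (assert (0 <= (a - d) ^ 2) by apply pow2_ge_0; lra).
split.
- replace (a * d) with ((e ^ 2 + 4) * s / (e + g)) by (rewrite ad; field; lra).
  replace (b * c) with ((g ^ 2 + 4) * s / (e + g)) by (rewrite bc; field; lra).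
  revert H1. unfold a, b. intros H1. field. split; lra.
- replace (s * (4 - e * g) / (e + g)) with (s * ((f * h - 4) / (f + h)))
    by (rewrite <- EQ; field; lra).
  replace (a * b) with ((f ^ 2 + 4) * s / (f + h)) by (rewrite ab; field; lra).
  replace (c * d) with ((h ^ 2 + 4) * s / (f + h)) by (rewrite cd; field; lra).
  revert H2. unfold a, d. intros H2. field. split; lra.
Qed.

(** * Integrality, divisors of 64 and parity *)

Lemma square_divides_square (p q m : Z) :
  (q <> 0 -> p * p = m * (q * q) -> (q | p))%Z.
Proof.
intros Hq E.
set (g := Z.gcd p q).
assert (Hg : (g <> 0)%Z) by (intros H; apply Z.gcd_eq_0_r in H; contradiction).
destruct (Z.gcd_divide_l p q) as [p' Ep]. destruct (Z.gcd_divide_r p q) as [q' Eq].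
fold g in Ep, Eq.
assert (Hc : Z.gcd p' q' = 1%Z).
{ replace p' with (p / g)%Z by (rewrite Ep; now apply Z.div_mul).
  replace q' with (q / g)%Z by (rewrite Eq; now apply Z.div_mul).
  now apply Z.gcd_div_gcd. }
assert (E' : (p' * p' = m * q' * q')%Z).
{ apply Z.mul_reg_r with (g * g)%Z; [lia |]. rewrite Ep, Eq in E. lia. }
assert (D : (q' | p')%Z).
{ apply Z.gauss with p'; [| now rewrite Z.gcd_comm]. exists (m * q')%Z. lia. }
destruct D as [k Ek]. exists k. rewrite Ep, Eq, Ek. ring.
Qed.

Lemma rational_sqrt_integer (x : R) (p q m : Z) :
  q <> 0%Z -> IZR q * x = IZR p -> x ^ 2 = IZR m -> exists n : Z, x = IZR n.
Proof.
intros Hq E Em.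
assert (Hq' : IZR q <> 0) by now apply not_0_IZR.
destruct (square_divides_square p q m Hq) as [n En].
- apply eq_IZR. rewrite !mult_IZR, <- E, <- Em. ring.
- exists n. apply Rmult_eq_reg_l with (IZR q); trivial.
  rewrite E, En, mult_IZR. ring.
Qed.

Lemma rational_sum_integer (x y : R) (m n N : Z) :
  0 < x + y -> x ^ 2 = IZR m -> y ^ 2 = IZR n -> 4 * (x + y) = IZR N ->
  exists k : Z, x = IZR k.
Proof.
intros H Em En EN.
apply (rational_sqrt_integer x (16 * (m - n) + N * N) (8 * N) m); trivial.
- assert (0 < IZR N) by lra. apply lt_IZR in H0. lia.
- rewrite plus_IZR, !mult_IZR, minus_IZR, <- Em, <- En, <- EN. ring.
Qed.

Lemma lattice_dot (P Q S : point) :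
  lattice_point P -> lattice_point Q -> lattice_point S ->
  exists z : Z, dot P Q S = IZR z.
Proof.
intros (p1 & p2 & ->) (q1 & q2 & ->) (s1 & s2 & ->).
exists ((q1 - p1) * (s1 - p1) + (q2 - p2) * (s2 - p2))%Z.
unfold dot; cbn [fst snd]. now rewrite plus_IZR, !mult_IZR, !minus_IZR.
Qed.

Lemma lattice_cross (P Q S : point) :
  lattice_point P -> lattice_point Q -> lattice_point S ->
  exists z : Z, cross P Q S = IZR z.
Proof.
intros (p1 & p2 & ->) (q1 & q2 & ->) (s1 & s2 & ->).
exists ((q1 - p1) * (s2 - p2) - (q2 - p2) * (s1 - p1))%Z.
unfold cross; cbn [fst snd]. now rewrite minus_IZR, !mult_IZR, !minus_IZR.
Qed.

Lemma unit_fractions_eighths (m n : Z) :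
  (0 < m -> 0 < n -> 8 * m + 8 * n = m * n ->
   (n = 16 \/ n = 24 \/ n = 40 \/ n = 72) \/ (m = 24 \/ m = 40 \/ m = 72))%Z.
Proof.
intros Hm Hn E.
assert (F : ((m - 8) * (n - 8) = 64)%Z) by lia.
assert (Hm8 : (8 < m)%Z) by nia.
assert (Hn8 : (8 < n)%Z) by nia.
set (x := (m - 8)%Z) in *. set (y := (n - 8)%Z) in *.
assert (Hx : (1 <= x <= 64)%Z) by nia.
assert (H : (y = 8 \/ y = 16 \/ y = 32 \/ y = 64 \/ x = 16 \/ x = 32 \/ x = 64)%Z).
{ assert (Dx : (x | 64)%Z) by (exists y; lia).
  assert (Hcase : (x = 1 \/ x = 2 \/ x = 4 \/ x = 8 \/ x = 16 \/ x = 32 \/ x = 64)%Z).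
  { apply Z.mod_divide in Dx; [| lia].
    assert (Hall : forallb (fun k => implb (64 mod k =? 0)
      (existsb (Z.eqb k) [1; 2; 4; 8; 16; 32; 64]))%Z
      (map Z.of_nat (List.seq 1 64)) = true) by reflexivity.
    rewrite forallb_forall in Hall. specialize (Hall x).
    rewrite Dx in Hall. cbn [Z.eqb implb] in Hall.
    assert (In x (map Z.of_nat (List.seq 1 64))).
    { apply in_map_iff. exists (Z.to_nat x). split; [lia |]. apply in_seq. lia. }
    apply Hall in H. cbn [existsb] in H.
    rewrite !Bool.orb_true_iff, !Z.eqb_eq in H. intuition (auto || discriminate). }
  destruct Hcase as [Ex | [Ex | [Ex | [Ex | [Ex | [Ex | Ex]]]]]]; rewrite Ex in F; lia. }
unfold x, y in H. lia.
Qed.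

Lemma even_of_square_mul4 (w z : Z) : (w * w = 4 * z -> Z.even w = true)%Z.
Proof.
intros E. assert (H : Z.even (w * w) = true) by (rewrite E, Z.even_mul; reflexivity).
rewrite Z.even_mul in H. destruct (Z.even w); [reflexivity | discriminate].
Qed.

(* With x the tangent length at the common vertex of p and q, [2 t x] is an
   integer whose square is divisible by 4. *)
Lemma parity_and_quadratic_identity (t x p q r : R) :
  In t [2; 3; 5; 9] ->
  (exists m, p = IZR m) -> (exists m, q = IZR m) -> (exists m, r = IZR m) ->
  (t = 2 -> even_real r) ->
  t * (x ^ 2 + 4) = p * q ->
  2 * t * x = p + t * q - (t - 1) * r ->
  same_parity p (t * q) /\
  let u := (t * q - p) / 2 in
  let v := (t * q + p) / 2 in
  (2 * t) ^ 2 + u ^ 2 = v ^ 2 - (v - (t - 1) / 2 * r) ^ 2.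
Proof.
intros Ht [p' Ep] [q' Eq] [r' Er] Hev E1 E2. split.
- assert (Hk : exists k, t = IZR k /\ Z.even ((k - 1) * r') = true).
  { destruct Ht as [<- | [<- | [<- | [<- | []]]]].
    - exists 2%Z. split; [reflexivity |]. destruct (Hev eq_refl) as (m & Em & Hm).
      rewrite Em in Er. apply eq_IZR in Er. subst r'.
      change (2 - 1)%Z with 1%Z. rewrite Z.mul_1_l. now apply Z.even_spec.
    - exists 3%Z. split; [reflexivity |]. now rewrite Z.even_mul.
    - exists 5%Z. split; [reflexivity |]. now rewrite Z.even_mul.
    - exists 9%Z. split; [reflexivity |]. now rewrite Z.even_mul. }
  destruct Hk as (k & Ek & Hk).
  exists p', (k * q')%Z. split; [exact Ep |]. split; [now rewrite mult_IZR, Ek, Eq |].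
  assert (W : Z.even (p' + k * q' - (k - 1) * r') = true).
  { apply even_of_square_mul4 with (k * (p' * q' - 4 * k))%Z. apply eq_IZR.
    rewrite !mult_IZR, !minus_IZR, !plus_IZR, !mult_IZR, minus_IZR.
    rewrite <- Ep, <- Eq, <- Er, <- Ek.
    rewrite <- E2, <- E1. ring. }
  rewrite Z.even_sub, Hk, Z.even_add in W.
  destruct (Z.even p'), (Z.even (k * q')); trivial; discriminate.
- cbn zeta.
  assert (E3 : (2 * t * x) ^ 2 = 4 * t * (p * q - 4 * t)) by (rewrite <- E1; ring).
  rewrite E2 in E3.
  replace ((t * q + p) / 2 - (t - 1) / 2 * r) with ((p + t * q - (t - 1) * r) / 2) by field.
  replace (((p + t * q - (t - 1) * r) / 2) ^ 2)
    with ((p + t * q - (t - 1) * r) ^ 2 / 4) by field.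
  rewrite E3. field.
Qed.

Lemma LEQ_integer_sides (O A B C : point) :
  LEQ O A B C -> counterclockwise O A B C ->
  seg_length O A + seg_length B C = seg_length A B + seg_length C O ->
  (exists m, seg_length O A = IZR m) /\ (exists m, seg_length A B = IZR m) /\
  (exists m, seg_length B C = IZR m) /\ (exists m, seg_length C O = IZR m).
Proof.
intros (_ & LO & LA & LB & LC & Harea) Hc E.
unfold counterclockwise in Hc. unfold area, perimeter in Harea.
rewrite Rabs_right in Harea by lra.
assert (E2 := two_signed_area O A B C).
destruct (lattice_cross O A C LO LA LC) as [z1 Z1].
destruct (lattice_cross B C A LB LC LA) as [z2 Z2].
destruct (lattice_dot O A A LO LA LA) as [a2 Ea].
destruct (lattice_dot A B B LA LB LB) as [b2 Eb].
destruct (lattice_dot B C C LB LC LC) as [c2 Ec].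
destruct (lattice_dot C O O LC LO LO) as [d2 Ed].
rewrite <- seg_length_sq in Ea, Eb, Ec, Ed. rewrite Z1, Z2, <- plus_IZR in E2.
repeat split.
- apply (rational_sum_integer _ _ a2 c2 (z1 + z2)) with (2 := Ea) (3 := Ec); lra.
- apply (rational_sum_integer _ _ b2 d2 (z1 + z2)) with (2 := Eb) (3 := Ed); lra.
- apply (rational_sum_integer _ _ c2 a2 (z1 + z2)) with (2 := Ec) (3 := Ea); lra.
- apply (rational_sum_integer _ _ d2 b2 (z1 + z2)) with (2 := Ed) (3 := Eb); lra.
Qed.

Theorem theorem1 :
  forall O A B C : point,
  let a := seg_length O A in
  let b := seg_length A B in
  let c := seg_length B C in
  let d := seg_length C O in
  let s := leq_sigma O A B C in
  let t := leq_tau O A B C in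
  LEQ O A B C ->
  tangential O A B C ->
  counterclockwise O A B C ->
  (~ convex O A B C -> reflex_at A B C) ->
  (s = 2 /\ t = 2 -> even_real a /\ even_real c) ->
  (* (i), (ii), (iii) *)
  Rabs (c - b) * t < a + c /\
  (a + d) * t > a + c /\
  (b + c) * t <> a + c /\
  (convex O A B C <-> (b + c) * t > a + c) /\
  (* at least one of the cases (I), (II) occurs *)
  (In t [2; 3; 5; 9] \/ In s [3; 5; 9]) /\
  (* (I) *)
  (In t [2; 3; 5; 9] ->
     same_parity a (t * b) /\
     let u := (t * b - a) / 2 in
     let v := (t * b + a) / 2 in
     (2 * t) ^ 2 + u ^ 2 = v ^ 2 - (v - (t - 1) / 2 * c) ^ 2) /\
  (* (II) *)
  (In s [3; 5; 9] ->
     same_parity a (s * d) /\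
     let u := (s * d - a) / 2 in
     let v := (s * d + a) / 2 in
     (2 * s) ^ 2 + u ^ 2 = v ^ 2 - (v - (s - 1) / 2 * c) ^ 2).
Proof.
intros O A B C a b c d s t HL HT Hccw Hreflex Heven.
destruct (tangential_leq_sides _ _ _ _ HL HT Hccw Hreflex)
  as (e & f & g & h & He & Hf & Hh & Hg & Hcv & Ea & Eb & Ec & Ed & HR & HX &
      DO & DA & Hin).
destruct (LEQ_integer_sides _ _ _ _ HL Hccw) as (Za & Zb & Zc & Zd).
{ rewrite Ea, Eb, Ec, Ed. ring. }
destruct HL as (_ & LO & LA & LB & LC & _).
assert (Hdelta : delta O A B C = 1 /\ e * g < 4 \/ delta O A B C = -1 /\ 4 <= e * g).
{ unfold delta. destruct (excluded_middle_informative _) as [H | H].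
  - left. split; [reflexivity | now apply Hin].
  - right. split; [reflexivity |]. apply Rnot_lt_le. intros H'. now apply H, Hin. }
destruct (sigma_tau_values e f g h Hf Hh HX HR _ Hdelta) as [Es Et].
rewrite <- Ea, <- Eb, <- Ec, <- Ed in Es, Et.
change (s = (a + c) / (e + g)) in Es. change (t = (a + c) / (f + h)) in Et.
fold a b c d in Ea, Eb, Ec, Ed, Za, Zb, Zc, Zd.
assert (HY : 0 < f + h) by lra.
assert (Eac : a + c = e + f + g + h) by lra.
rewrite <- Eac in DO, DA.
assert (Hac : 0 < a + c) by lra.
assert (EsX : s * (e + g) = a + c) by (rewrite Es; field; lra).
assert (EtY : t * (f + h) = a + c) by (rewrite Et; field; lra).
assert (Hs : 0 < s) by (rewrite Es; now apply Rdiv_lt_0_compat).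
assert (Ht : 0 < t) by (rewrite Et; now apply Rdiv_lt_0_compat).
assert (ad : s * (e ^ 2 + 4) = a * d).
{ apply Rmult_eq_reg_r with (e + g); [| lra].
  transitivity ((s * (e + g)) * (e ^ 2 + 4)); [ring |].
  rewrite EsX, Eac, Ea, Ed,  Rmult_plus_distr_l.
  rewrite (Rmult_comm _ 4), HR. ring. }
assert (ab : t * (f ^ 2 + 4) = a * b).
{ apply Rmult_eq_reg_r with (f + h); [| lra].
  transitivity ((t * (f + h)) * (f ^ 2 + 4)); [ring |].
  rewrite EtY, Eac, Ea, Eb, Rmult_plus_distr_l.
  rewrite (Rmult_comm _ 4), HR. ring. }
assert (Hst : s + t = s * t).
{ apply Rmult_eq_reg_r with ((e + g) * (f + h)); [| nra].
  transitivity ((s * (e + g)) * (f + h) + (t * (f + h)) * (e + g)); [ring |].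
  transitivity ((s * (e + g)) * (t * (f + h))); [| ring].
  rewrite EsX, EtY, Eac. ring. }
assert (Zs : exists m, 8 * s = IZR m).
{ destruct (lattice_dot O A C LO LA LC) as [z Ez].
  destruct Za as [za Za], Zd as [zd Zd]. exists (za * zd - z)%Z.
  rewrite minus_IZR, mult_IZR, <- Za, <- Zd, <- Ez, <- ad.
  replace (dot O A C) with (s * (e ^ 2 - 4)); [ring |].
  apply Rmult_eq_reg_r with (e + g); [rewrite DO, <- EsX; ring | lra]. }
assert (Zt : exists m, 8 * t = IZR m).
{ destruct (lattice_dot A O B LA LO LB) as [z Ez].
  destruct Za as [za Za], Zb as [zb Zb]. exists (za * zb - z)%Z.
  rewrite minus_IZR, mult_IZR, <- Za, <- Zb, <- Ez, <- ab.
  replace (dot A O B) with (t * (f ^ 2 - 4)); [ring |].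
  apply Rmult_eq_reg_r with (f + h); [rewrite DA, <- EtY; ring | lra]. }
assert (Hb : forall x, x * t > a + c <-> x > f + h).
{ intros x. rewrite <- EtY, (Rmult_comm x). split; intros H.
  - now apply Rmult_lt_reg_l in H.
  - now apply Rmult_lt_compat_l. }
assert (E2t : t = 2 -> even_real c).
{ intros E. apply Heven. split; [nra | exact E]. }
split; [| split; [| split; [| split; [| split; [| split]]]]].
- rewrite <- EtY, (Rmult_comm t). apply Rmult_lt_compat_r; trivial.
  apply Rabs_def1; lra.
- apply Hb. lra.
- rewrite <- EtY, (Rmult_comm t). intros H. apply Rmult_eq_reg_r in H; lra.
- rewrite Hcv, Hb. lra.
- destruct Zs as [m Em], Zt as [n En].
  assert (Hm : (0 < m)%Z) by (apply lt_IZR; lra).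
  assert (Hn : (0 < n)%Z) by (apply lt_IZR; lra).
  assert (E : (8 * m + 8 * n = m * n)%Z).
  { apply eq_IZR. rewrite plus_IZR, !mult_IZR, <- Em, <- En. lra. }
  cbn [In].
  destruct (unit_fractions_eighths m n Hm Hn E)
    as [[-> | [-> | [-> | ->]]] | [-> | [-> | ->]]]; lra.
- intros H. apply (parity_and_quadratic_identity t f); trivial.
  replace (2 * t * f) with (t * (f + h) + t * (b - c)) by (rewrite Eb, Ec; ring).
  rewrite EtY. ring.
- intros H. apply (parity_and_quadratic_identity s e); trivial.
  + now right.
  + intros E. exfalso. rewrite E in H. cbn [In] in H. lra.
  + replace (2 * s * e) with (s * (e + g) + s * (d - c)) by (rewrite Ec, Ed; ring).
    rewrite EsX. ring.
Qed.
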